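(* There exists a robust MDP $(\mathcal{S},\mathcal{A},\boldsymbol{r},\mathcal{U},\boldsymbol{p}_0)$ with an sa-rectangular compact convex uncertainty set $\mathcal{U}$ such that, for every stationary policy $\pi\in\Pi_{\sf S}$, the infimum $\inf_{\boldsymbol{P}\in\mathcal{U}}R_{\sf avg}(\pi,\boldsymbol{P})$ is not attained.
   Context: A robust MDP (RMDP) is a tuple $(\mathcal{S},\mathcal{A},\boldsymbol{r},\mathcal{U},\boldsymbol{p}_0)$: $\mathcal{S}$ (states) and $\mathcal{A}$ (actions) are finite nonempty sets, $\boldsymbol{r}\in\mathbb{R}^{\mathcal{S}\times\mathcal{A}\times\mathcal{S}}$ is the reward function, the uncertainty set $\mathcal{U}\subset\Delta(\mathcal{S})^{\mathcal{S}\times\mathcal{A}}$ is a nonempty compact set of transition probabilities $\boldsymbol{P}=(\boldsymbol{p}_{sa})_{s,a}$, and $\boldsymbol{p}_0\in\Delta(\mathcal{S})$ is the initial distribution; $\Delta(\mathcal{S})$ is the simplex of probability distributions on $\mathcal{S}$. The set $\mathcal{U}$ is sa-rectangular if $\mathcal{U}=\prod_{(s,a)\in\mathcal{S}\times\mathcal{A}}\mathcal{U}_{sa}$ with $\mathcal{U}_{sa}\subseteq\Delta(\mathcal{S})$. $\Pi_{\sf S}$ is the set of stationary (possibly randomized) policies, i.e. maps $\mathcal{S}\to\Delta(\mathcal{A})$. $\mathbb{E}_{\pi,\boldsymbol{P}}$ is expectation with respect to the law of $(s_t,a_t)_{t\ge0}$ induced by $\pi$ and $\boldsymbol{P}$.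 The average return is $$R_{\sf avg}(\pi,\boldsymbol{P})=\mathbb{E}_{\pi,\boldsymbol{P}}\Big[\limsup_{T\to+\infty}\tfrac{1}{T+1}\sum_{t=0}^{T} r_{s_ta_ts_{t+1}}\ \Big|\ s_0\sim\boldsymbol{p}_0\Big].$$ *)

(* Defs.v *)
From HB Require Import structures.
From mathcomp Require Import all_boot all_order all_algebra.
From mathcomp Require Import all_classical all_reals all_analysis.
From mathcomp Require Import lra.

Set Implicit Arguments.
Unset Strict Implicit.
Unset Printing Implicit Defensive.

Import Order.TTheory GRing.Theory Num.Theory.
Import numFieldNormedType.Exports.

Local Open Scope classical_set_scope.
Local Open Scope ring_scope.

(* Finite nonempty sets.  The point only witnesses nonemptiness; [measurableType]
   requires one. *)
#[short(type=nonemptyFinType)]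
HB.structure Definition NonemptyFinite := {T of Pointed T & Finite T}.

HB.instance Definition _ (S A : nonemptyFinType) := Pointed.on (S * A)%type.

Definition simplex (R : realType) (T : finType) : set (T -> R) :=
  [set p | (forall x, 0 <= p x) /\ \sum_x p x = 1].

(* [P (s, a)] is the vector p_sa.  The index sets are finite, so the topology of
   pointwise convergence is the usual one on R^(S x A x S). *)
Definition transition (R : realType) (S A : nonemptyFinType) : Type :=
  {ptws (S * A)%type -> {ptws S -> R}}.

Record rmdp (R : realType) := RMDP {
  state : nonemptyFinType ;
  action : nonemptyFinType ;
  reward : state -> action -> state -> R ;
  uncertainty : set (transition R state action) ;
  init : state -> R ;
  uncertainty_nonempty : uncertainty !=set0 ;
  uncertainty_compact :
    compact (uncertainty : set {ptws (state * action)%type -> {ptws state -> R}}) ;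
  uncertainty_simplex :
    forall P, uncertainty P -> forall sa, simplex (P sa) ;
  init_simplex : simplex init
}.

Arguments reward {R} r s a s' : rename.
Arguments uncertainty {R} r _ : rename.
Arguments init {R} r s : rename.

Definition sa_rectangular (R : realType) (S A : nonemptyFinType)
    (U : set (transition R S A)) : Prop :=
  exists2 Usa : S * A -> set (S -> R),
    (forall sa, Usa sa `<=` @simplex R S) &
    U = [set P | forall sa, Usa sa (P sa)].

Definition convex_uncertainty (R : realType) (S A : nonemptyFinType)
    (U : set (transition R S A)) : Prop :=
  convex_set (U : set (convex_lmodType (S * A -> S -> R^o))).

Definition stationary_policy (R : realType) (S A : nonemptyFinType)
    : set (S -> A -> R) :=
  [set pi | forall s, simplex (pi s)].

Definition cylinder (T : Type) (w : nat -> T) (n : nat) : set (nat -> T) :=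
  [set w' | forall t, (t <= n)%N -> w' t = w t].

(* Sequences (s_t, a_t)_t with the product sigma-algebra: the cylinders are the
   sets fixing finitely many initial coordinates, and S x A is finite. *)
Definition trajectory (S A : nonemptyFinType) :=
  g_sigma_algebraType
    [set cylinder wn.1 wn.2 | wn in [set: (nat -> S * A) * nat]].

Definition history_prob (R : realType) (S A : nonemptyFinType) (p0 : S -> R)
    (pi : S -> A -> R) (P : transition R S A) (w : nat -> S * A) (n : nat) : R :=
  p0 (w 0%N).1 * pi (w 0%N).1 (w 0%N).2 *
  \prod_(t < n) (P (w t) (w t.+1).1 * pi (w t.+1).1 (w t.+1).2).

Definition is_trajectory_law (R : realType) (S A : nonemptyFinType)
    (p0 : S -> R) (pi : S -> A -> R) (P : transition R S A)
    (mu : probability (trajectory S A) R) : Prop :=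
  forall w n, mu (cylinder w n) = (history_prob p0 pi P w n)%:E.

(* [get] picks the measure satisfying the predicate; [trajectory_law_exists] and
   [trajectory_law_unique] below show that there is exactly one whenever p0, pi
   and P consist of probability distributions. *)
Definition trajectory_law (R : realType) (S A : nonemptyFinType)
    (p0 : S -> R) (pi : S -> A -> R) (P : transition R S A)
    : probability (trajectory S A) R :=
  get [set mu | is_trajectory_law p0 pi P mu].

(* Rewards are bounded, so the real-valued [limn_sup] is the usual limsup and
   the expectation is finite. *)
Definition average_return (R : realType) (M : rmdp R)
    (pi : state M -> action M -> R) (P : transition R (state M) (action M))
    : \bar R :=
  'E_(trajectory_law (init M) pi P)[fun w : trajectory (state M) (action M) =>
     (limn_sup (fun T : nat => T.+1%:R^-1 *
       \sum_(0 <= t < T.+1) reward M (w t).1 (w t).2 (w t.+1).1))%R]%E.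

Arguments average_return {R} M pi P.

Lemma trajectory_law_unique (R : realType) (S A : nonemptyFinType)
    (p0 : S -> R) (pi : S -> A -> R) (P : transition R S A)
    (mu nu : probability (trajectory S A) R) :
  is_trajectory_law p0 pi P mu -> is_trajectory_law p0 pi P nu ->
  forall B, measurable B -> mu B = nu B.
Proof.
move=> Lmu Lnu B mB.
pose G : set (set (trajectory S A)) := [set C | C = set0 \/ C = setT \/
   exists wn : (nat -> S * A) * nat, C = cylinder wn.1 wn.2].
have GM : @measurable _ (trajectory S A) = <<s G >>.
  apply/seteqP; split.
    apply: smallest_sub; first exact: smallest_sigma_algebra.
    move=> _ [wn _ <-]; apply: sub_sigma_algebra; right; right; by exists wn.
  apply: smallest_sub; first exact: sigma_algebra_measurable.
  move=> C [->|[->|[wn ->]]]; [exact: measurable0|exact: measurableT|].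
  by apply: sub_sigma_algebra; exists wn.
have Gcap w n w' m : (n <= m)%N -> G (cylinder w n `&` cylinder w' m).
  move=> nm; have [E|NE] := pselect (forall t, (t <= n)%N -> w' t = w t).
    right; right; exists (w', m) => /=; apply/seteqP; split => [v []//|v Cv].
    by split=> // t tn; rewrite Cv ?E// (leq_trans tn).
  left; apply/seteqP; split => // v [Cv Cv']; apply: NE => t tn.
  by rewrite -Cv// Cv'// (leq_trans tn).
have GI : setI_closed G.
  move=> C D [->|[->|[[w n] ->]]]; first by rewrite set0I; left.
    by rewrite setTI.
  move=> [->|[->|[[w' m] ->]]]; first by rewrite setI0; left.
    by rewrite setIT; right; right; exists (w, n).
  have [nm|/ltnW mn] := leqP n m; first exact: Gcap.
  by rewrite setIC; exact: Gcap.
apply: (measure_unique G (fun=> setT)) => //.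
- by move=> _; right; left.
- by rewrite bigcup_const.
- move=> C [->|[->|[wn ->]]]; first by rewrite !measure0.
    exact: etrans (probability_setT mu) (esym (probability_setT nu)).
  exact: etrans (Lmu _ _) (esym (Lnu _ _)).
- by move=> _; apply: (@le_lt_trans _ _ 1%E); [exact: probability_le1|exact: ltry].
Qed.

(* The law of a Markov chain on a finite set X is built as the image of Lebesgue
   measure on [0, 1[ by iterated inverse-CDF sampling: a distribution q on X
   splits [0, 1[ into consecutive intervals [sample_low q x, sample_low q x + q x[,
   and rescaling the interval that contains u yields the seed of the next draw. *)
Section sampling.
Variables (R : realType) (X : finType).
Implicit Types (q : X -> R) (x : X) (u : R).

Let psum q (k : nat) : R := \sum_(y | (enum_rank y < k)%N) q y.

Definition sample_low q x : R := psum q (enum_rank x).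

Let psumS q x : psum q (enum_rank x).+1 = sample_low q x + q x.
Proof.
rewrite /sample_low /psum (bigD1 x)//= addrC; congr (_ + _).
apply: eq_bigl => y; rewrite ltnS ltn_neqAle andbC; congr (_ && _).
by rewrite -(inj_eq enum_rank_inj).
Qed.

Let psum_le q k l : simplex q -> (k <= l)%N -> psum q k <= psum q l.
Proof.
move=> [q0 _] kl; rewrite /psum [leRHS]big_mkcond [leLHS]big_mkcond.
apply: ler_sum => y _; case: ifPn => [yk|_]; last by case: ifP.
by rewrite (leq_trans yk).
Qed.

Lemma sample_low_ge0 q x : simplex q -> 0 <= sample_low q x.
Proof. by case=> q0 _; apply: sumr_ge0. Qed.

Lemma sample_high_le1 q x : simplex q -> sample_low q x + q x <= 1.
Proof.
move=> qs; rewrite -psumS; have [_ <-] := qs.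
have -> : \sum_x q x = psum q #|X| by apply: eq_bigl => y; rewrite ltn_ord.
by apply: psum_le.
Qed.

Lemma sample_exists q u : simplex q -> 0 <= u < 1 ->
  exists x, sample_low q x <= u < sample_low q x + q x.
Proof.
move=> qs /andP[u0 u1].
have ex : exists k, u < psum q k.
  exists #|X|; rewrite (_ : psum q #|X| = 1)//; have [_ <-] := qs.
  by apply: eq_bigl => y; rewrite ltn_ord.
have [[|k] uk kmin] := ex_minnP ex.
  by move: uk; rewrite /psum big_pred0// ltNge u0.
have kX : (k < #|X|)%N.
  rewrite ltnNge; apply/negP => Xk; suff /kmin : u < psum q k by rewrite ltnn.
  rewrite (_ : psum q k = psum q k.+1)//; apply: eq_bigl => y.
  by rewrite !(leq_trans (ltn_ord _))// leqW.
exists (enum_val (Ordinal kX)); rewrite -psumS /sample_low enum_valK/= uk andbT.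
by rewrite leNgt; apply/negP => /kmin; rewrite ltnn.
Qed.

Lemma sample_uniq q u x y : simplex q ->
  sample_low q x <= u < sample_low q x + q x ->
  sample_low q y <= u < sample_low q y + q y -> x = y.
Proof.
move=> qs; rewrite -!psumS /sample_low => /andP[xu ux] /andP[yu uy].
apply/enum_rank_inj/val_inj/eqP; rewrite eqn_leq.
apply/andP; split; rewrite leqNgt; apply/negP => h.
  by have := le_lt_trans (le_trans (psum_le qs h) xu) uy; rewrite ltxx.
by have := le_lt_trans (le_trans (psum_le qs h) yu) ux; rewrite ltxx.
Qed.

End sampling.

Section markov_chain.
Variables (R : realType) (X : nonemptyFinType) (q0 : X -> R) (K : X -> X -> R).
Hypothesis q0s : simplex q0.
Hypothesis Ks : forall x, simplex (K x).

Let sample (q : X -> R) (u : R) : X * R :=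
  let x := get [set x | sample_low q x <= u < sample_low q x + q x] in
  (x, (u - sample_low q x) / q x).

Let sampleP q u x : simplex q -> 0 <= u < 1 ->
  reflect ((sample q u).1 = x) (sample_low q x <= u < sample_low q x + q x).
Proof.
move=> qs u01; have := getPex (sample_exists qs u01) => /= h.
by apply: (iffP idP) => [xu|<-//]; apply: sample_uniq xu.
Qed.

Let sample_itv q u : simplex q -> 0 <= u < 1 -> 0 <= (sample q u).2 < 1.
Proof.
move=> qs u01; have := getPex (sample_exists qs u01) => /= /andP[h1 h2].
have q_gt0 : 0 < q (get [set x | sample_low q x <= u < sample_low q x + q x]).
  by move: h1 h2; set x := get _ => ? ?; lra.
by rewrite divr_ge0 ?subr_ge0 ?(ltW q_gt0)//= ltr_pdivrMr// mul1r ltrBlDl.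
Qed.

Let sampleK q u x : simplex q -> 0 <= u < 1 -> (sample q u).1 = x ->
  u = sample_low q x + q x * (sample q u).2.
Proof.
move=> qs u01 xE; have /(sampleP x qs u01)/andP[h1 h2] := xE.
have qx0 : q x != 0 by apply/eqP => E; move: h2; rewrite E addr0 ltNge h1.
have -> : (sample q u).2 = (u - sample_low q x) / q x by rewrite -xE.
by rewrite mulrC divfK// addrCA subrr addr0.
Qed.

Let Fixpoint run (u : R) (n : nat) : X * R :=
  if n is m.+1 then sample (K (run u m).1) (run u m).2 else sample q0 u.

Let Fixpoint low (w : nat -> X) (n : nat) : R :=
  if n is m.+1
  then low w m + q0 (w 0%N) * (\prod_(t < m) K (w t) (w t.+1)) *
         sample_low (K (w m)) (w n)
  else sample_low q0 (w 0%N).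

Let len (w : nat -> X) n := q0 (w 0%N) * \prod_(t < n) K (w t) (w t.+1).

Let run_itv u n : 0 <= u < 1 -> 0 <= (run u n).2 < 1.
Proof. by move=> u01; elim: n => [|n IH]; apply: sample_itv. Qed.

Let len_ge0 w n : 0 <= len w n.
Proof.
by apply: mulr_ge0; [case: q0s|apply: prodr_ge0 => t _; case: (Ks (w t))].
Qed.

Let lenS w n : len w n.+1 = len w n * K (w n) (w n.+1).
Proof. by rewrite /len big_ord_recr/= mulrA. Qed.

Let run_cyl u w n : 0 <= u < 1 ->
  (cylinder w n (fun t => (run u t).1) <-> low w n <= u < low w n + len w n) /\
  (cylinder w n (fun t => (run u t).1) -> u = low w n + len w n * (run u n).2).
Proof.
move=> u01; elim: n => [|n [IH1 IH2]].
  have lenE : len w 0 = q0 (w 0%N) by rewrite /len big_ord0 mulr1.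
  have cE : cylinder w 0 (fun t => (run u t).1) <-> (sample q0 u).1 = w 0%N.
    by split=> [/(_ 0%N)|h [|]//]; exact.
  split; first by rewrite cE lenE; exact: (rwP (sampleP _ _ _)).
  by move=> /cE h; rewrite lenE; exact: sampleK.
have cE : cylinder w n.+1 (fun t => (run u t).1) <->
    cylinder w n (fun t => (run u t).1) /\ (run u n.+1).1 = w n.+1.
  split=> [h|[h1 h2] t]; first by split=> [t tn|]; apply: h => //; exact: leqW.
  by rewrite leq_eqVlt => /orP[/eqP ->//|]; rewrite ltnS; exact: h1.
have v01 := run_itv n u01.
have l0 := sample_low_ge0 (w n.+1) (Ks (w n)).
have l1 := sample_high_le1 (w n.+1) (Ks (w n)).
have K0 : 0 <= K (w n) (w n.+1) by case: (Ks (w n)).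
have lowS : low w n.+1 = low w n + len w n * sample_low (K (w n)) (w n.+1) by [].
have key : cylinder w n (fun t => (run u t).1) ->
    ((run u n.+1).1 = w n.+1 <-> low w n.+1 <= u < low w n.+1 + len w n.+1).
  move=> C; have uE := IH2 C; have /IH1 uI := C.
  have L0 : 0 < len w n by lra.
  rewrite [run u n.+1]/= (C n (leqnn n)) lowS lenS -addrA -mulrDr.
  rewrite [X in _ <= X]uE [X in X < _]uE lerD2l ltrD2l ler_pM2l// ltr_pM2l//.
  by split=> /(sampleP _ (Ks _) v01).
split.
  apply: (iff_trans cE); split=> [[C h]|h]; first by apply/key.
  suff C : cylinder w n (fun t => (run u t).1) by split=> //; apply/key.
  apply/IH1; move: h; rewrite lowS lenS => /andP[h1 h2].
  apply/andP; split; first by rewrite (le_trans _ h1)// lerDl mulr_ge0.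
  by rewrite (lt_le_trans h2)// -addrA lerD2l -mulrDr ler_piMr.
move=> /cE[C h]; rewrite {1}(IH2 C) lowS lenS -addrA -mulrA -mulrDr.
congr (_ + _ * _); move: h; rewrite [run u n.+1]/= (C n (leqnn n)).
exact: sampleK.
Qed.

Let clamp (u : R) : R := if 0 <= u < 1 then u else 0.

Let clamp01 u : 0 <= clamp u < 1.
Proof. by rewrite /clamp; case: ifP => // _; rewrite lexx ltr01. Qed.

Let Omega := g_sigma_algebraType
  [set cylinder wn.1 wn.2 | wn in [set: (nat -> X) * nat]].

Let traj (u : R) : Omega := fun t => (run (clamp u) t).1.

Let traj_cyl w n : traj @^-1` cylinder w n `&` `[0, 1[ =
  [set` `[low w n, low w n + len w n[].
Proof.
apply/seteqP; split=> u /=.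
  move=> [C]; rewrite !in_itv/= => u01; move: C.
  by rewrite /traj /clamp u01 => /(run_cyl _ _ u01).1.
rewrite !in_itv/= => uI.
have u01 : 0 <= u < 1.
  have [L0 L1] : 0 <= low w n /\ low w n + len w n <= 1.
    elim: (n) => [|k [IH1 IH2]].
      rewrite /len big_ord0 mulr1 /=.
      by split; [exact: sample_low_ge0|exact: sample_high_le1].
    have -> : low w k.+1 = low w k + len w k * sample_low (K (w k)) (w k.+1) by [].
    rewrite lenS; have l0 := sample_low_ge0 (w k.+1) (Ks (w k)).
    have l1 := sample_high_le1 (w k.+1) (Ks (w k)).
    split; first exact: addr_ge0 IH1 (mulr_ge0 (len_ge0 w k) l0).
    by rewrite -addrA (le_trans _ IH2)// lerD2l -mulrDr ler_piMr.
  move: uI => /andP[h1 h2].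
  by rewrite (le_trans L0 h1) (lt_le_trans h2 L1).
by split=> //; rewrite /traj /clamp u01; apply/(run_cyl _ _ u01).1.
Qed.

Let measurable_traj : measurable_fun [set: R] traj.
Proof.
apply: (@measurability _ _ _ Omega setT traj [set cylinder wn.1 wn.2 |
  wn in [set: (nat -> X) * nat]] erefl) => _ [_ [[w n] _ <-] <-] /=.
rewrite setTI.
have -> : traj @^-1` cylinder w n =
    (traj @^-1` cylinder w n `&` `[0, 1[) `|`
    (~` `[0, 1[%classic `&` [set u : R | cylinder w n (traj 0)]).
  apply/seteqP; split=> u /=.
    move=> C; have [u01|nu01] := pselect (`[0, 1[%classic u); [by left|right; split=> //].
    by move: C nu01; rewrite /traj /= {1}/clamp in_itv/= /clamp lexx ltr01; case: ifP.
  move=> [[]//|[nu01]]; move: nu01; rewrite /traj /= in_itv/= /clamp lexx ltr01/=.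
  by case: ifP.
apply: measurableU; first by rewrite traj_cyl.
apply: measurableI; first exact: measurableC.
have [h|h] := pselect (cylinder w n (traj 0)).
  by rewrite (_ : [set _ | _] = setT)//; apply/seteqP; split.
by rewrite (_ : [set _ | _] = set0)//; apply/seteqP; split.
Qed.

Lemma markov_chain_law_exists : exists mu : probability Omega R, forall w n,
  mu (cylinder w n) = (q0 (w 0%N) * \prod_(t < n) K (w t) (w t.+1))%:E.
Proof.
have mI : measurable (`[0, 1[%classic : set R) by [].
pose m : {measure set _ -> \bar R} := mrestr (@lebesgue_measure R) mI.
have [nu nuE] : {nu : {measure set Omega -> \bar R} |
    forall B, nu B = pushforward m traj B}.
  by unshelve eexists (pushforward m traj : {measure set Omega -> \bar R}).
have nuT : nu setT = 1%E.
  rewrite nuE /pushforward /m /= /mrestr preimage_setT setTI.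
  by rewrite lebesgue_measure_itv/= lte01 oppr0 adde0.
exists (mnormalize nu point) => w n; rewrite /= /mnormalize nuT.
rewrite onee_eq0/= invr1 mule1 nuE /pushforward /m /= /mrestr traj_cyl.
rewrite lebesgue_measure_itv/= lte_fin -EFinD.
have := len_ge0 w n; rewrite le_eqVlt => /orP[/eqP L0|L0].
  by rewrite -/(len w n) -L0 addr0 ltxx.
by rewrite ltrDl L0 addrAC subrr add0r.
Qed.
End markov_chain.

Lemma trajectory_law_exists (R : realType) (S A : nonemptyFinType)
    (p0 : S -> R) (pi : S -> A -> R) (P : transition R S A) :
  simplex p0 -> stationary_policy pi -> (forall sa, simplex (P sa)) ->
  exists mu, is_trajectory_law p0 pi P mu.
Proof.
move=> p0s pis Ps.
have step p : simplex p -> simplex (fun x : S * A => p x.1 * pi x.1 x.2).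
  move=> [p_ge0 p1]; split=> [x|].
    by rewrite mulr_ge0//; case: (pis x.1).
  rewrite -(pair_bigA _ (fun s a => p s * pi s a))/= -[RHS]p1.
  apply: eq_bigr => s _; rewrite -mulr_sumr.
  by case: (pis s) => _ ->; rewrite mulr1.
exact: (markov_chain_law_exists (step _ p0s) (fun x => step _ (Ps x))).
Qed.

Lemma trajectory_lawP (R : realType) (S A : nonemptyFinType)
    (p0 : S -> R) (pi : S -> A -> R) (P : transition R S A) :
  simplex p0 -> stationary_policy pi -> (forall sa, simplex (P sa)) ->
  is_trajectory_law p0 pi P (trajectory_law p0 pi P).
Proof. by move=> p0s pis Ps; exact: getPex (trajectory_law_exists p0s pis Ps). Qed.

(* Main.v *)
(* One action and three states: [start], and the absorbing states [bad] and
   [good]; the reward is 0 in [bad] and 1 elsewhere.  From [start] the next state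
   is drawn from a distribution p with p bad ^+ 2 <= p good.  If p good > 0 the
   chain is absorbed in [good] with positive probability; otherwise p bad = 0 and
   it stays in [start] forever.  So the average return is always positive.  For
   p bad = a and p good = a ^+ 2 it is a / (1 + a), which is arbitrarily small.
   Absorption probabilities are sums over the individual trajectories that are
   eventually constant, whose mass is the limit of the mass of their cylinders. *)
From HB Require Import structures.
Require Import Defs.
From mathcomp Require Import all_boot all_order all_algebra.
From mathcomp Require Import all_classical all_reals all_analysis.
From mathcomp Require Import ring lra zify.

Set Implicit Arguments.
Unset Strict Implicit.
Unset Printing Implicit Defensive.

Import Order.TTheory GRing.Theory Num.Theory.
Import numFieldNormedType.Exports.

Local Open Scope classical_set_scope.
Local Open Scope ring_scope.

HB.instance Definition _ n := isPointed.Build 'I_n.+1 ord0.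

(** * Bounds on limits superior and expectations *)

Lemma limn_sup_itv (R : realType) (u : nat -> R) (a b : R) :
  (forall n, a <= u n <= b) -> a <= limn_sup u <= b.
Proof.
move=> uab.
(* Boundedness identifies [limn_sup u] with the infimum of the tail suprema [sups u], each of which
   lies in [[a, b]]. *)
have bu : bounded_fun (u : nat -> R^o).
  exists (`|a| + `|b|); split=> // M /ltW abM n _; apply: le_trans abM.
  have /andP[an nb] := uab n; rewrite ler_norml; apply/andP; split.
    by rewrite (le_trans _ an)// lerNl (le_trans (ler_norm _))// normrN lerDl.
  by rewrite (le_trans nb)// (le_trans (ler_norm b))// lerDr.
have supab n : a <= sups u n <= b.
  rewrite /sups /sdrop; apply/andP; split.
    apply: (@le_trans _ _ (u n)); first by case/andP: (uab n).
    apply: ub_le_sup; last by exists n => //=.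
    by exists b => _ [k _ <-]; case/andP: (uab k).
  apply: ge_sup; first by exists (u n), n => //=.
  by move=> _ [k _ <-]; case/andP: (uab k).
rewrite limn_supE//; apply/andP; split.
  apply: lb_le_inf; first by exists (sups u 0), 0%N.
  by move=> _ [n _ <-]; case/andP: (supab n).
apply: (@le_trans _ _ (sups u 0)); last by case/andP: (supab 0%N).
apply: ge_inf; last by exists 0%N.
by exists a => _ [n _ <-]; case/andP: (supab n).
Qed.

(** The integral of a nonnegative function is a supremum over the simple functions below it, so the
    comparison applies directly to limits superior such as [longrun]. *)
Lemma expectation_mono d (T : measurableType d) (R : realType)
    (P : probability T R) (X Y : T -> R) :
  (forall x, 0 <= X x) -> (forall x, X x <= Y x) -> ('E_P[X] <= 'E_P[Y])%E.
Proof.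
move=> X0 XY; have Y0 x : 0 <= Y x by rewrite (le_trans (X0 x)).
rewrite unlock ge0_integralE; last by move=> x _; rewrite lee_fin.
rewrite ge0_integralE; last by move=> x _; rewrite lee_fin.
apply: le_ereal_sup => _ [h /= hX <-]; exists h => //= x.
by rewrite (le_trans (hX x))// !patch_setT lee_fin.
Qed.

(** * Mass of a single trajectory *)

Section trajectory_singleton.
Variables (R : realType) (S A : nonemptyFinType).

Lemma measurable_cylinder (w : nat -> S * A) n :
  measurable (cylinder w n : set (trajectory S A)).
Proof. by apply: sub_sigma_algebra; exists (w, n). Qed.

Lemma bigcap_cylinder (T : Type) (w : nat -> T) : \bigcap_n cylinder w n = [set w].
Proof.
apply/seteqP; split=> [v vw|_ -> n _ t]//.
by apply/funext => t; exact: (vw t).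
Qed.

Lemma measurable_trajectory1 (w : nat -> S * A) :
  measurable ([set w] : set (trajectory S A)).
Proof.
rewrite -bigcap_cylinder; apply: bigcapT_measurable => n.
exact: measurable_cylinder.
Qed.

(** A singleton is the decreasing intersection of its cylinders, so by continuity from above its
    mass is the limit of their masses, here eventually constant. *)
Lemma trajectory_law1 (p0 : S -> R) (pi : S -> A -> R) (P : transition R S A)
    (mu : probability (trajectory S A) R) (w : nat -> S * A) (c : R) (N : nat) :
  is_trajectory_law p0 pi P mu ->
  (forall n, (N <= n)%N -> history_prob p0 pi P w n = c) ->
  mu [set w] = c%:E.
Proof.
move=> Lmu hc; rewrite -bigcap_cylinder.
have cv : (mu \o cylinder w) x @[x --> \oo] --> mu (\bigcap_n cylinder w n).
  apply: nonincreasing_cvg_mu.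
  - by apply: le_lt_trans (probability_le1 mu (measurable_cylinder w 0)) (ltry 1).
  - by move=> i; exact: measurable_cylinder.
  - by rewrite bigcap_cylinder; exact: measurable_trajectory1.
  - move=> m n mn; apply/subsetPset => v vw t tm.
    by apply: vw; exact: leq_trans mn.
have cv' : (mu \o cylinder w) x @[x --> \oo] --> c%:E.
  apply: cvg_near_cst; near=> n; rewrite /= Lmu hc//.
  by near: n; exact: nbhs_infty_ge.
exact: cvg_unique cv cv'.
Unshelve. all: by end_near. Qed.

End trajectory_singleton.


(** * The three-state robust MDP *)

Section counterexample.
Variable R : realType.

Definition start : 'I_3 := ord0.
Definition bad : 'I_3 := lift ord0 ord0.
Definition good : 'I_3 := ord_max.

Definition reward_ex (s : 'I_3) (a : 'I_1) (s' : 'I_3) : R := (s != bad)%:R.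

Definition init_ex (s : 'I_3) : R := (s == start)%:R.

(** The square allows the ratio of [p good] to [p bad] to be arbitrarily small, yet makes [p bad]
    vanish with [p good]; it also keeps the set closed and convex. *)
Definition Usa_ex (sa : 'I_3 * 'I_1) : set ('I_3 -> R) :=
  [set p | simplex p /\
    (if sa.1 == start then p bad ^+ 2 <= p good else p sa.1 == 1)].

Definition U_ex : set (transition R 'I_3 'I_1) :=
  [set P | forall sa, Usa_ex sa (P sa)].

Lemma sum_I3 (p : 'I_3 -> R) : \sum_x p x = p start + p bad + p good.
Proof.
rewrite !big_ord_recl big_ord0 addr0 addrA; congr (_ + _ + p _).
exact: val_inj.
Qed.

Lemma I3P (s : 'I_3) : [\/ s = start, s = bad | s = good].
Proof.
case: s => [[|[|[|//]]] i]; [apply: Or31|apply: Or32|apply: Or33]; exact: val_inj.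
Qed.

(** From [start], the extreme case of equality in [p bad ^+ 2 <= p good]. *)
Definition kernel_ex (a : R) : transition R 'I_3 'I_1 := fun sa s' =>
  if sa.1 == start then
    if s' == start then 1 - a - a ^+ 2 else if s' == bad then a else a ^+ 2
  else (s' == sa.1)%:R.

Lemma kernel_exP a : 0 <= a <= 2^-1 -> U_ex (kernel_ex a).
Proof.
move=> /andP[a0 a1] [s x]; split; last first.
  by rewrite /kernel_ex/=; have [_|s0] := eqVneq s start; rewrite ?eqxx ?lexx.
split; last first.
  by rewrite sum_I3 /kernel_ex/=; case: (I3P s) => -> /=; lra.
move=> y; rewrite /kernel_ex; case: ifP => _; last exact: ler0n.
(* The bound [a <= 2^-1] makes [1 - a - a ^+ 2] at least 1/4. *)
case: ifP => _; first by nra.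
by case: ifP => _ //; exact: sqr_ge0.
Qed.

(** * Compactness and convexity of the uncertainty set *)

Lemma simplex_le1 (T : finType) (p : T -> R) x : simplex p -> p x <= 1.
Proof.
by move=> [p0 <-]; rewrite (bigD1 x)//= lerDl; exact: sumr_ge0.
Qed.

(** Tychonoff is used twice: it reduces the claim to one factor [Usa_ex sa], and it makes the cube
    of functions into [[0, 1]] compact. The factor is a closed subset of that cube. *)
Lemma U_ex_compact :
  compact (U_ex : set {ptws ('I_3 * 'I_1)%type -> {ptws 'I_3 -> R}}).
Proof.
apply: (@tychonoff ('I_3 * 'I_1)%type (fun=> {ptws 'I_3 -> R}) Usa_ex) => sa.
have pc s : continuous (fun p : {ptws 'I_3 -> R} => p s : R).
  exact: (@proj_continuous _ (fun=> R)).
have cD (f g : {ptws 'I_3 -> R} -> R) : continuous f -> continuous g ->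
    continuous (fun p => f p + g p).
  by move=> cf cg p; apply: (@continuousD _ _ _ f g); [exact: cf|exact: cg].
have cle (f g : {ptws 'I_3 -> R} -> R) : continuous f -> continuous g ->
    closed [set p | f p <= g p].
  move=> cf cg; rewrite (_ : [set _ | _] = (g \- f) @^-1` [set x : R | 0 <= x]).
    apply: preimage_closed; last exact: closed_ge.
    by move=> p _; apply: continuousB; [exact: cg|exact: cf].
  by apply/seteqP; split=> p /=; rewrite subr_ge0.
have ceq (f g : {ptws 'I_3 -> R} -> R) : continuous f -> continuous g ->
    closed [set p | f p == g p].
  move=> cf cg; rewrite (_ : [set _ | _] =
      [set p | f p <= g p] `&` [set p | g p <= f p]).
    by apply: closedI; exact: cle.
  by apply/seteqP; split=> p /=; rewrite eq_le => /andP.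
apply: (@subclosed_compact _ _
  [set p : {ptws 'I_3 -> R} | forall s, `[0, 1]%classic (p s)]).
- rewrite (_ : Usa_ex sa = \bigcap_s [set p : {ptws 'I_3 -> R} | 0 <= p s] `&`
      [set p : {ptws 'I_3 -> R} | \sum_s p s == 1] `&`
      [set p : {ptws 'I_3 -> R} |
        if sa.1 == start then p bad ^+ 2 <= p good else p sa.1 == 1]); last first.
    apply/seteqP; split=> p /=.
      by move=> [[p0 p1] h]; split=> //; split=> [s _|]; [exact: p0|exact/eqP].
    by move=> [[p0 /eqP p1] h]; split=> //; split=> // s; exact: p0.
  apply: closedI; first apply: closedI.
  + by apply: closed_bigI => s _; apply: cle => //; exact: cst_continuous.
  + apply: ceq; last exact: cst_continuous.
    rewrite (_ : (fun _ => _) =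
        fun p : {ptws 'I_3 -> R} => p start + p bad + p good).
      exact: (cD _ _ (cD _ _ (pc _) (pc _)) (pc _)).
    by apply/funext => p; exact: sum_I3.
  + case: (sa.1 == start).
      apply: (cle (fun p => p bad ^+ 2) (fun p => p good)); last exact: pc.
      pose f (p : {ptws 'I_3 -> R}) : R := p bad.
      by move=> p; apply: (@continuousM _ _ f f); exact: pc.
    by apply: ceq => //; exact: cst_continuous.
- apply: (@tychonoff 'I_3 (fun=> R) (fun=> `[0, 1]%classic)) => s.
  exact: segment_compact.
- move=> p [ps _] s /=; rewrite in_itv/= simplex_le1// andbT.
  by case: ps.
Qed.

Lemma U_ex_convex : convex_uncertainty U_ex.
Proof.
move=> P Q k; rewrite !inE => PU QU sa.
have [[P0 P1] Ph] := PU sa; have [[Q0 Q1] Qh] := QU sa.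
have t0 : 0 <= k%:inum by exact: ge0.
have t1 : k%:inum <= 1 by exact: le1.
set t := k%:inum in t0 t1.
have E s : conv k P Q sa s = t * P sa s + (1 - t) * Q sa s by [].
split; first split.
- by move=> s; rewrite E addr_ge0// mulr_ge0// subr_ge0.
- under eq_bigr do rewrite E.
  by rewrite big_split/= -!mulr_sumr P1 Q1; ring.
- case: ifP Ph Qh => _ Ph Qh; rewrite !E; last first.
    by rewrite (eqP Ph) (eqP Qh); apply/eqP; ring.
  (* This is the convexity gap of the square: [t * x ^+ 2 + (1 - t) * y ^+ 2 - (t * x + (1 - t) * y)
     ^+ 2 = t * (1 - t) * (x - y) ^+ 2]. *)
  have : 0 <= t * (1 - t) * (P sa bad - Q sa bad) ^+ 2.
    by apply: mulr_ge0; [apply: mulr_ge0; rewrite ?subr_ge0|exact: sqr_ge0].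
  have := ler_wpM2l t0 Ph; have : 0 <= 1 - t by rewrite subr_ge0.
  by move=> t2; have := ler_wpM2l t2 Qh; nra.
Qed.

Lemma init_exP : simplex init_ex.
Proof.
split=> [s|]; first exact: ler0n.
by rewrite sum_I3 /init_ex/= !addr0.
Qed.

Lemma U_ex_neq0 : U_ex !=set0.
Proof. by exists (kernel_ex 0); apply: kernel_exP; lra. Qed.

Definition rmdp_ex : rmdp R :=
  @RMDP R 'I_3 'I_1 reward_ex U_ex init_ex U_ex_neq0 U_ex_compact
    (fun P PU sa => (PU sa).1) init_exP.

(** * Long-run reward along individual trajectories *)

Definition longrun (w : nat -> 'I_3 * 'I_1) : R :=
  limn_sup (fun T : nat => T.+1%:R^-1 *
    \sum_(0 <= t < T.+1) reward_ex (w t).1 (w t).2 (w t.+1).1).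

Lemma longrun_itv w : 0 <= longrun w <= 1.
Proof.
apply: limn_sup_itv => T; apply/andP; split.
  by rewrite mulr_ge0 ?invr_ge0// sumr_ge0// => t _; exact: ler0n.
rewrite mulrC ler_pdivrMr ?ltr0n// mul1r -[in leRHS](subn0 T.+1) -sumr_const_nat.
by apply: ler_sum => t _; rewrite /reward_ex lern1 leq_b1.
Qed.

Lemma longrun_not_bad w : (forall t, (w t).1 != bad) -> longrun w = 1.
Proof.
move=> wb; apply/eqP; rewrite eq_le andbC; apply: limn_sup_itv => T.
have -> : \sum_(0 <= t < T.+1) reward_ex (w t).1 (w t).2 (w t.+1).1 = T.+1%:R.
  under eq_bigr do rewrite /reward_ex wb.
  by rewrite sumr_const_nat subn0.
by rewrite mulVf ?pnatr_eq0// lexx.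
Qed.

(** Taking [c := start] gives the trajectory that never leaves [start], so both ways of avoiding
    [bad] are covered. *)
Definition absorbed_path (n : nat) (c : 'I_3) (t : nat) : 'I_3 * 'I_1 :=
  (if (t < n)%N then start else c, ord0).

(** Only the first [n] steps earn a reward, so the averages are squeezed between 0 and
    [n / (T + 1)]. *)
Lemma longrun_bad n : longrun (absorbed_path n bad) = 0.
Proof.
apply: (cvg_limn_inf_sup _).2.
have -> : (fun T : nat => T.+1%:R^-1 * \sum_(0 <= t < T.+1)
    reward_ex (absorbed_path n bad t).1 (absorbed_path n bad t).2
      (absorbed_path n bad t.+1).1) = fun T => T.+1%:R^-1 * (minn T.+1 n)%:R.
  apply/funext => T; congr (_ * _); elim: T.+1 => [|k IH].
    by rewrite big_geq// min0n.
  rewrite big_nat_recr//= IH -natrD /reward_ex /=; congr _%:R.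
  by case: ltnP => /= kn; lia.
apply: (@squeeze_cvgr _ _ _ _ (cst 0) (fun T => T.+1%:R^-1 * n%:R)).
- near=> T; rewrite mulr_ge0 ?invr_ge0//=.
  by rewrite ler_wpM2l ?invr_ge0// ler_nat geq_minr.
- exact: cvg_cst.
- rewrite -[X in _ --> X](mul0r n%:R); apply: cvgM; last exact: cvg_cst.
  exact: cvg_harmonic.
Unshelve. all: by end_near. Qed.

(** * Mass of the absorbed trajectories *)

Lemma history_prob_absorbed (pi : 'I_3 -> 'I_1 -> R) (P : transition R 'I_3 'I_1)
    (c : 'I_3) (n m : nat) :
  stationary_policy pi -> P (c, ord0) c = 1 -> (n < m)%N ->
  history_prob init_ex pi P (absorbed_path n.+1 c) m =
    P (start, ord0) start ^+ n * P (start, ord0) c.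
Proof.
move=> pis Pc; set w := absorbed_path _ _; set q := P _ start.
(* With a single action, every policy plays it with probability 1. *)
have pi1 s x : pi s x = 1.
  by rewrite (ord1 x); case: (pis s) => _; rewrite big_ord1.
have step k : history_prob init_ex pi P w k.+1 =
    history_prob init_ex pi P w k * P (w k) (w k.+1).1.
  by rewrite /history_prob big_ord_recr/= [pi (w k.+1).1 _]pi1 mulr1 mulrA.
have wE i : w i = (if (i <= n)%N then start else c, ord0) by [].
have hn k : (k <= n)%N -> history_prob init_ex pi P w k = q ^+ k.
  elim: k => [|k IH] kn.
    by rewrite /history_prob big_ord0 /init_ex/= pi1 !mulr1.
  by rewrite step (IH (ltnW kn)) exprSr !wE kn ltnW.
(* Time [n] is the last one in [start]: the next step contributes the factor [P (start, ord0) c],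
   and all later ones contribute [P (c, ord0) c = 1]. *)
elim: m => // m IH; rewrite ltnS leq_eqVlt => /predU1P[<-|nm].
  by rewrite step (hn n (leqnn n)) !wE leqnn ltnn.
by rewrite step (IH nm) !wE (leqNgt m n) (leqNgt m.+1 n) nm ltnS (ltnW nm)
  Pc mulr1.
Qed.

Lemma trajectory_law_absorbed (pi : 'I_3 -> 'I_1 -> R)
    (P : transition R 'I_3 'I_1) (c : 'I_3) (n : nat) :
  stationary_policy pi -> U_ex P -> P (c, ord0) c = 1 ->
  trajectory_law init_ex pi P [set absorbed_path n.+1 c] =
    (P (start, ord0) start ^+ n * P (start, ord0) c)%:E.
Proof.
move=> pis PU Pc.
have Plaw := trajectory_lawP init_exP pis (fun sa => (PU sa).1).
apply: (trajectory_law1 (N := n.+1) Plaw) => m nm.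
exact: history_prob_absorbed.
Qed.

(** * Bounds on the average return *)

Lemma average_return_gt0 (pi : 'I_3 -> 'I_1 -> R) (P : transition R 'I_3 'I_1) :
  stationary_policy pi -> U_ex P ->
  exists2 c : R, 0 < c <= 1 & (c%:E <= average_return rmdp_ex pi P)%E.
Proof.
move=> pis PU.
(* One trajectory avoiding [bad] has positive mass: jump to [good] at once if that is possible;
   otherwise [p bad] vanishes too and [start] is itself absorbing. *)
have [c [cb Pc c0]] : exists c,
    [/\ c != bad, P (c, ord0) c = 1 & 0 < P (start, ord0) c].
  have [[P0 P1]] := PU (start, ord0); rewrite /= => Pbg.
  have := P0 good; rewrite le_eqVlt => /predU1P[Pg|Pg]; last first.
    exists good; split=> //.
    by have [_ /= /eqP] := PU (good, ord0).
  have Pb : P (start, ord0) bad = 0.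
    by apply/eqP; rewrite -sqrf_eq0 eq_le sqr_ge0 Pg Pbg.
  by exists start; move: P1; rewrite sum_I3 Pb -Pg !addr0 => ->.
exists (P (start, ord0) c).
  by rewrite c0/=; apply: simplex_le1; exact: (PU _).1.
have mw : measurable ([set absorbed_path 1 c] : set (trajectory 'I_3 'I_1)).
  exact: measurable_trajectory1.
have := trajectory_law_absorbed 0 pis PU Pc; rewrite expr0 mul1r => <-.
(* The long-run reward dominates the indicator of this trajectory, being 1 on it and nonnegative
   elsewhere. *)
rewrite -expectation_indic//; apply: expectation_mono => w.
  by rewrite indicE ler0n.
rewrite indicE; case: (boolP (w \in _)) => [|_]; last first.
  by case/andP: (longrun_itv w).
rewrite inE => ->; rewrite [leRHS]longrun_not_bad// => t.
by rewrite /absorbed_path/=; case: ifP.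
Qed.

(** Absorption in [bad] has probability [a / (a + a ^+ 2) = 1 / (1 + a)], by summing a geometric
    series over the absorption time. The long-run reward is 0 on that event and at most 1 off it. *)
Lemma average_return_kernel_ex (pi : 'I_3 -> 'I_1 -> R) (a : R) :
  stationary_policy pi -> 0 < a <= 2^-1 ->
  (average_return rmdp_ex pi (kernel_ex a) <= (a / (1 + a))%:E)%E.
Proof.
move=> pis /andP[a0 a1].
have KU : U_ex (kernel_ex a) by apply: kernel_exP; rewrite ltW.
set mu := trajectory_law init_ex pi (kernel_ex a).
pose F n : set (trajectory 'I_3 'I_1) := [set absorbed_path n.+1 bad].
have mF n : measurable (F n) by exact: measurable_trajectory1.
have tF : trivIset setT F.
  apply/trivIsetP => i j _ _ ij; apply/seteqP; split=> // w [-> wij].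
  wlog : i j ij wij / (i < j)%N.
    move=> H; have [/H|/H|/eqP] := ltngtP i j; [exact| |by rewrite (negPf ij)].
    by apply=> //; rewrite eq_sym.
  (* At time [i.+1] the path of index [i] is already in [bad], while that of index [j] is still in
     [start]. *)
  move=> lij; have := congr1 (fun w : nat -> 'I_3 * 'I_1 => (w i.+1).1) wij.
  by rewrite /absorbed_path/= ltnn ltnS lij.
have q1 : `|1 - a - a ^+ 2| < 1 by rewrite ltr_norml; apply/andP; split; nra.
have muF : mu (\bigcup_n F n) = (1 / (1 + a))%:E.
  rewrite measure_semi_bigcup//; last exact: bigcupT_measurable.
  rewrite (_ : 1 / (1 + a) = a / (1 - (1 - a - a ^+ 2))); last first.
    by field; apply/andP; split; nra.
  apply/cvg_lim => //.
  rewrite (_ : (fun n => _) = EFin \o series (geometric a (1 - a - a ^+ 2))).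
    by apply: cvg_EFin; [near=> n|exact: cvg_geometric_series].
  apply/funext => n; rewrite /= /series/= -sumEFin; apply: eq_bigr => i _.
  by rewrite [LHS]trajectory_law_absorbed//= mulrC.
have mA : measurable (\bigcup_n F n) by exact: bigcupT_measurable.
have -> : a / (1 + a) = 1 - 1 / (1 + a) by field; nra.
(* The bound becomes the expectation of the indicator of the complement of absorption in [bad]. *)
rewrite EFinB -muF -probability_setC// -expectation_indic; last exact: measurableC.
apply: expectation_mono => w; first by case/andP: (longrun_itv w).
rewrite indicE in_setC; case: (boolP (w \in _)) => [|_]; last first.
  by case/andP: (longrun_itv w).
by rewrite inE => -[n _ ->]; rewrite [leLHS]longrun_bad.
Unshelve. all: by end_near. Qed.

End counterexample.

Theorem proposition3p2 (R : realType) :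
  exists M : rmdp R,
    [/\ sa_rectangular (uncertainty M),
        convex_uncertainty (uncertainty M) &
        forall pi : state M -> action M -> R, stationary_policy pi ->
          ~ exists2 P, uncertainty M P &
              average_return M pi P =
              ereal_inf [set average_return M pi Q | Q in uncertainty M]].
Proof.
exists (rmdp_ex R); split; [|exact: U_ex_convex|].
  by exists (@Usa_ex R) => // sa p [].
move=> pi pis [P PU Pinf].
have [c /andP[c0 c1] cP] := average_return_gt0 pis PU.
(* If [P] attained the infimum, the infimum would be at least [c]; but the kernel with [a = c / 2],
   admissible because [c <= 1], has return at most [a / (1 + a) < c]. *)
have a2 : 0 < c / 2 <= 2^-1 by lra.
have aU : U_ex (kernel_ex (c / 2)) by apply: kernel_exP; lra.
have := average_return_kernel_ex pis a2; rewrite leNgt => /negP; apply.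
apply: (@lt_le_trans _ _ c%:E).
  by rewrite lte_fin ltr_pdivrMr; nra.
apply: (le_trans cP); rewrite Pinf; apply: ereal_inf_lbound.
by exists (kernel_ex (c / 2)).
Qed.
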